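(* Let $v\geq 2$ and $n\geq 2$ be integers. Then for every integer $L\geq 0$, \[ G\!\left(L-2^{n-2},\,L+2^{n-2},\,2v\Big(\tfrac{2^n-2^{-n}}{3}\Big)+\tfrac{2^n+2^{1-n}}{3},\,2v\Big(\tfrac{2^n-2^{-n}}{3}\Big)+\tfrac{2^{2-n}-2^n}{3},\,2^nv,\,q\right)\geq 0, \] i.e. this polynomial in $q$ has nonnegative coefficients.
   Context: For integers $n\ge0$, $(q)_n=\prod_{j=1}^{n}(1-q^j)$; for integers $m,n$, ${n+m \brack n}_q=\frac{(q)_{n+m}}{(q)_n(q)_m}$ if $m,n\geq 0$ and $0$ otherwise. For integers $N,M$, real $\alpha,\beta$ and positive integer $K$ (with the exponents below integers), $G(N,M,\alpha,\beta,K,q)=\sum_{j=-\infty}^{\infty}(-1)^jq^{Kj\frac{(\alpha+\beta)j+(\alpha-\beta)}{2}}{N+M \brack N-Kj}_q$. For a polynomial $P(q)$, $P(q)\geq 0$ means all its coefficients are nonnegative. *)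

(* Defs.v *)
From HB Require Import structures.
From mathcomp Require Import all_boot all_order all_algebra.
From mathcomp Require Import archimedean.
From mathcomp Require Import boolp classical_sets functions cardinality fsbigop reals.
From mathcomp Require Import zify ring lra.

Set Implicit Arguments.
Unset Strict Implicit.
Unset Printing Implicit Defensive.

Import Order.TTheory GRing.Theory Num.Theory.
Local Open Scope ring_scope.
Local Open Scope classical_set_scope.

Section QSeries.
Context {F : fieldType}.
Implicit Type q : F.

Definition qfact q (n : nat) : F := \prod_(1 <= j < n.+1) (1 - q ^+ j).

(* [a] is the upper and [b] the lower entry of the bracket. *)
Definition qbinom q (a b : int) : F :=
  if (0 <= b) && (0 <= a - b)
  then qfact q (absz a) / (qfact q (absz b) * qfact q (absz (a - b)))
  else 0.

Context {R : realType}.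

Definition Gexponent (alpha beta : R) (K : nat) (j : int) : R :=
  K%:R * j%:~R * (((alpha + beta) * j%:~R + (alpha - beta)) / 2).

(* [Num.floor] only reads a real number known to be an integer as an [int];
   exponents may be negative, whence the integer power [_ ^ _].  The sum is
   over all integers; it has finite support when [0 < K]
   (see [G_finite_support]). *)
Definition G (N M : int) (alpha beta : R) (K : nat) q : F :=
  \sum_(j \in [set: int])
    ((-1) ^ j * q ^ Num.floor (Gexponent alpha beta K j)
     * qbinom q (N + M) (N - K%:Z * j)).

Lemma G_finite_support (N M : int) (alpha beta : R) (K : nat) q :
  (0 < K)%N ->
  finite_set ((fun j : int =>
    (-1) ^ j * q ^ Num.floor (Gexponent alpha beta K j)
    * qbinom q (N + M) (N - K%:Z * j)) @^-1` [set~ 0]).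
Proof.
move=> K0; set b := (`|N| + `|M|)%N.
apply: (@sub_finite_set _ _ ((fun i : nat => i%:Z - b%:Z) @` `I_(b.*2.+1))).
  move=> j /= nz; have : (0 <= N - K%:Z * j) && (0 <= (N + M) - (N - K%:Z * j)).
    by apply/negPn/negP => /negbTE h; apply: nz; rewrite /qbinom h mulr0.
  case/andP => h1 h2; rewrite /b.
  have j1 : j <= `|N|%N%:Z by nia.
  have j2 : - `|M|%N%:Z <= j by nia.
  by exists (absz (j + (`|N| + `|M|)%N%:Z)) => /=; lia.
exact/finite_image/finite_II.
Qed.

End QSeries.

(* The formal variable q, in the field of rational functions Q(q). *)
Definition qvar : {fraction {poly int}} := tofrac 'X.

Definition coefs_ge0 (P : {fraction {poly int}}) : Prop :=
  exists2 p : {poly int}, P = tofrac p & forall i : nat, 0 <= p`_i.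

Lemma Gexponent_int (R : realType) (v n : nat) (j : int) :
  Gexponent
    (2 * v%:R * ((2 ^+ n - 2 ^- n) / 3) + (2 ^+ n + 2 ^ (1 - n%:Z)) / 3 : R)
    (2 * v%:R * ((2 ^+ n - 2 ^- n) / 3) + (2 ^ (2 - n%:Z) - 2 ^+ n) / 3 : R)
    (2 ^ n * v)%N j \is a Num.int.
Proof.
have [m Em] : exists m : nat, (4 ^ n = 3 * m + 1)%N.
  elim: n => [|k [m IH]]; first by exists 0%N.
  by exists (4 * m + 1)%N; rewrite expnS IH; lia.
have t0 : (2 : R) ^+ n != 0 by rewrite expf_neq0 // pnatr_eq0.
have two0 : (2 : R) != 0 by rewrite pnatr_eq0.
have mE : m%:R = ((2 : R) ^+ n * 2 ^+ n - 1) / 3.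
  by rewrite -exprMn -natrM -natrX Em natrD natrM; field.
set x := Gexponent _ _ _ _.
suff -> : x = (v%:Z * j * (2 * v%:Z * m%:Z * j + j + m%:Z))%:~R.
  exact: intr_int.
rewrite /x /Gexponent !expfzDr // -!exprnN.
rewrite natrM natrX !(rmorphM, rmorphD) /= -!pmulrn mE.
by field.
Qed.

(* Main.v *)
(* Linearising q-Vandermonde expands q^(2 a^2) [2L, L - 2a] as a combination of
   the [2k, k - a] whose coefficients are nonnegative polynomials independent of
   [a].  Applied to the defining sum, this writes the polynomial of level n + 1
   (up to a power of q) as a nonnegative combination of those of level n.  Two
   variants, for [2L, L - 2a - 1] and [2L + 1, L - 2a], continue the descent from
   level 2 down to the sums of (-1)^j q^(v j^2) [n, N - v j].  These are
   nonnegative by the two q-Pascal recurrences, which for |2N - n| < v only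
   involve these sums and those with j^2 replaced by j (j - 1); the latter
   vanish at the boundary 2N - n = v. *)
Require Import Defs.
From HB Require Import structures.
From mathcomp Require Import all_boot all_order all_algebra.
From mathcomp Require Import archimedean boolp classical_sets fsbigop reals.
From mathcomp Require Import zify ring.

Set Implicit Arguments.
Unset Strict Implicit.
Unset Printing Implicit Defensive.

Import Order.TTheory GRing.Theory Num.Theory.
Local Open Scope ring_scope.

(** * Sums over the integers with bounded support *)

Lemma fsbig_int_interval (V : nmodType) (lo : int) (w : nat) (f : int -> V) :
  (forall x, ~~ (lo <= x < lo + w%:Z) -> f x = 0) ->
  \sum_(x \in [set: int]) f x = \sum_(i < w) f (lo + i%:Z).
Proof.
move=> f0; rewrite (fsbigE [seq lo + i%:Z | i <- index_iota 0 w]).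
- rewrite big_map big_mkord.
  by apply: eq_bigl => i; rewrite in_setT.
- by rewrite map_inj_uniq ?iota_uniq // => x y; lia.
- by [].
- move=> x _ xP; apply: f0; apply: contra xP => /andP[h1 h2].
  by apply/mapP; exists (absz (x - lo)); rewrite ?mem_index_iota; lia.
Qed.

(** Both windows contain the support of [f], so each sum equals the sum over all integers. *)
Lemma sum_ord_shift (V : nmodType) (n : nat) (c : int) (f : int -> V) :
  (forall x, ~~ (0 <= x <= n%:Z) -> f x = 0) ->
  (forall x, ~~ (c <= x <= c + n%:Z) -> f x = 0) ->
  \sum_(i < n.+1) f i%:Z = \sum_(i < n.+1) f (c + i%:Z).
Proof.
move=> f0 fc; rewrite -(@fsbig_int_interval _ c n.+1 f); last first.
  by move=> x xP; apply: fc; lia.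
rewrite (@fsbig_int_interval _ 0 n.+1 f); last by move=> x xP; apply: f0; lia.
by apply: eq_bigr => i _; rewrite add0r.
Qed.

(** * Gaussian binomials: Pascal rules and trinomial revision *)

Section QBinomial.
Context {F : fieldType} (q : F).
Implicit Types (a b k : int) (n m : nat).

Lemma qfact0 : qfact q 0 = 1.
Proof. by rewrite /qfact big_nil. Qed.

Lemma qfactS n : qfact q n.+1 = qfact q n * (1 - q ^+ n.+1).
Proof. by rewrite /qfact big_nat_recr. Qed.

Lemma qbinom_out a k : ~~ (0 <= k <= a) -> qbinom q a k = 0.
Proof. by move=> kP; rewrite /qbinom subr_ge0 (negbTE kP). Qed.

Lemma qbinomE n m :
  qbinom q (n + m)%N%:Z n%:Z = qfact q (n + m) / (qfact q n * qfact q m).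
Proof.
rewrite /qbinom; have -> : (n + m)%N%:Z - n%:Z = m%:Z by lia.
by rewrite !le0z_nat !absz_nat.
Qed.

Lemma qbinom_sym a k : qbinom q a (a - k) = qbinom q a k.
Proof.
rewrite /qbinom; have -> : a - (a - k) = k by lia.
rewrite andbC; case: ifP => // _.
by rewrite [qfact q `|k| * _]mulrC.
Qed.

Hypothesis qX1 : forall n, (0 < n)%N -> q ^+ n != 1.

Lemma qfact_neq0 n : qfact q n != 0.
Proof.
elim: n => [|n IH]; first by rewrite qfact0 oner_neq0.
by rewrite qfactS mulf_neq0 // subr_eq0 eq_sym qX1.
Qed.

Lemma qbinom0 n : qbinom q n%:Z 0 = 1.
Proof.
by rewrite -[n]add0n qbinomE qfact0 mul1r divff // qfact_neq0.
Qed.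

Lemma qbinom_diag n : qbinom q n%:Z n%:Z = 1.
Proof. by rewrite -qbinom_sym subrr qbinom0. Qed.

Lemma qbinomSl n k :
  qbinom q n.+1%:Z k = qbinom q n%:Z (k - 1) + q ^ k * qbinom q n%:Z k.
Proof.
case: (boolP (0 <= k <= n.+1%:Z)) => [/andP[k0 kn]|kP]; last first.
  by rewrite !qbinom_out; [rewrite mulr0 addr0| lia | lia | lia].
case: k k0 kn => // -[|a] _ kn.
  by rewrite !qbinom0 (@qbinom_out _ (0 - 1)) // add0r expr0z mul1r.
have -> : a.+1%:Z - 1 = a%:Z by lia.
have [{kn} an|an] := ltnP a n; last first.
  have -> : n = a by lia.
  by rewrite !qbinom_diag (@qbinom_out _ a.+1) ?mulr0 ?addr0 //; lia.
have [c ->] : exists c, n = (a + c.+1)%N by exists (n - a).-1; lia.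
rewrite (qbinomE a c.+1) (qbinomE a.+1 c.+1).
rewrite [in X in _ + X]addnS (qbinomE a.+1 c).
rewrite -exprnP !addSn !addnS !qfactS.
have := @qX1 a.+1 isT; have := @qX1 c.+1 isT.
rewrite ![_ == 1]eq_sym -!(subr_eq0 1).
(* Apart from the factorials, the claim is 1 - q^(s+t) = (1 - q^s) + q^s (1 - q^t) with s = a + 1
   and t = c + 1. *)
have -> : (a + c).+2 = (a.+1 + c.+1)%N by lia.
rewrite exprD; move: (qfact_neq0 a) (qfact_neq0 c).
move: (qfact q a) (qfact q c) (qfact _ _) (q ^+ _) (q ^+ _).
by move=> x y z s t x0 y0 t1 s1; field; rewrite x0 y0 s1 t1.
Qed.

Lemma qbinomSr n k :
  qbinom q n.+1%:Z k =
  qbinom q n%:Z k + q ^ (n.+1%:Z - k) * qbinom q n%:Z (k - 1).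
Proof.
rewrite -qbinom_sym qbinomSl.
have -> : n.+1%:Z - k - 1 = n%:Z - k by lia.
have -> : n.+1%:Z - k = n%:Z - (k - 1) by lia.
by rewrite !qbinom_sym.
Qed.

(** Both sides are the q-multinomial (q)_n / ((q)_r (q)_(a-r) (q)_(b-r) (q)_(n-a-b+r)); if one of
    the indices is negative, both vanish. *)
Lemma qtrinomial a b (r : nat) n :
  qbinom q n%:Z a * qbinom q a r%:Z * qbinom q (n%:Z - a) (b - r%:Z) =
  qbinom q n%:Z r%:Z * qbinom q (n%:Z - r%:Z) (a + b - 2 * r%:Z)
    * qbinom q (a + b - 2 * r%:Z) (b - r%:Z).
Proof.
case: (boolP [&& 0 <= a - r%:Z, 0 <= b - r%:Z & a + b <= n%:Z + r%:Z]) => [|H].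
  case/and3P => h1 h2 h3.
  have [x aE] : exists x : nat, a = (r + x)%N%:Z by exists (absz (a - r%:Z)); lia.
  have [y bE] : exists y : nat, b = (r + y)%N%:Z by exists (absz (b - r%:Z)); lia.
  subst a b.
  have [w ->] : exists w : nat, n = (r + x + y + w)%N.
    by exists (n - (r + x + y))%N; lia.
  have -> : (r + x + y + w)%N%:Z - (r + x)%N%:Z = (y + w)%N%:Z by lia.
  have -> : (r + y)%N%:Z - r%:Z = y%:Z by lia.
  have -> : (r + x)%N%:Z + (r + y)%N%:Z - 2 * r%:Z = (y + x)%N%:Z by lia.
  have -> : (r + x + y + w)%N%:Z - r%:Z = (y + x + w)%N%:Z by lia.
  rewrite -addnA !qbinomE.
  have -> : (r + x + (y + w) = r + (y + x + w))%N by lia.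
  rewrite !qbinomE.
  have := qfact_neq0 (r + x); have := qfact_neq0 (y + w); have := qfact_neq0 (y + x).
  have := qfact_neq0 (y + x + w).
  have := qfact_neq0 r; have := qfact_neq0 x; have := qfact_neq0 y.
  have := qfact_neq0 w => *; field.
  by do ?[apply/andP; split].
have [ar|ar] := ltP (a - r%:Z) 0.
  rewrite (@qbinom_out a r) ?(@qbinom_out (a + b - _)); try lia.
  by rewrite !(mulr0, mul0r).
have [br|br] := ltP (b - r%:Z) 0.
  rewrite (@qbinom_out (n%:Z - a)) ?(@qbinom_out (a + b - _)); try lia.
  by rewrite !mulr0.
rewrite (@qbinom_out (n%:Z - a)) ?(@qbinom_out (n%:Z - r%:Z)); try lia.
by rewrite !(mulr0, mul0r).
Qed.

(** * The q-Vandermonde sum and linearisation *)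

Hypothesis q0 : q != 0.

(** Induction on [m] with the Pascal rule on both sides. The free bound [w] keeps the range fixed
    while [m] grows; terms with i > m vanish. *)
Lemma q_vandermonde m n w k : (m <= w)%N ->
  qbinom q (m + n)%N%:Z k =
  \sum_(i < w.+1) q ^ ((m%:Z - i%:Z) * (k - i%:Z)) * qbinom q m%:Z i%:Z
                  * qbinom q n%:Z (k - i%:Z).
Proof.
elim: m k => [|m IH] k mw.
  rewrite big_ord_recl big1 => [|i _]; last first.
    by rewrite (@qbinom_out 0%:Z) ?mulr0 ?mul0r // /bump /=; lia.
  by rewrite addr0 /= qbinom0 mulr1 !subr0 mul0r mul1r.
rewrite addSn qbinomSl !IH ?(ltnW mw) //.
under [RHS]eq_bigr => i _ do rewrite qbinomSl mulrDr mulrDl.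
rewrite big_split /=; congr (_ + _).
  pose f (x : int) := q ^ ((m%:Z - x) * (k - 1 - x)) * qbinom q m%:Z x
                      * qbinom q n%:Z (k - 1 - x).
  rewrite (@sum_ord_shift _ w (-1) f); first last.
  - by move=> x xP; rewrite /f (@qbinom_out m) ?mulr0 ?mul0r //; lia.
  - by move=> x xP; rewrite /f (@qbinom_out m) ?mulr0 ?mul0r //; lia.
  apply: eq_bigr => i _; rewrite /f [-1 + _]addrC.
  have -> : k - 1 - (i%:Z - 1) = k - i%:Z by ring.
  by have -> : m%:Z - (i%:Z - 1) = m.+1%:Z - i%:Z by lia.
rewrite mulr_sumr; apply: eq_bigr => i _; rewrite !mulrA; congr (_ * _ * _).
by rewrite -!expfzDr //; congr (_ ^ _); lia.
Qed.

(** Vandermonde for n = a + (n - a) expands the second factor; trinomial revision then regroups each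
    term. *)
Lemma qbinom_mul n a b :
  qbinom q n%:Z a * qbinom q n%:Z b =
  \sum_(r < n.+1) q ^ ((a - r%:Z) * (b - r%:Z)) * qbinom q n%:Z r%:Z
    * qbinom q (n%:Z - r%:Z) (a + b - 2 * r%:Z)
    * qbinom q (a + b - 2 * r%:Z) (b - r%:Z).
Proof.
transitivity (\sum_(r < n.+1) q ^ ((a - r%:Z) * (b - r%:Z)) *
   (qbinom q n%:Z a * qbinom q a r%:Z * qbinom q (n%:Z - a) (b - r%:Z))); last first.
  by apply: eq_bigr => r _; rewrite qtrinomial !mulrA.
case: (boolP (0 <= a <= n%:Z)) => [/andP[]|aP]; last first.
  by rewrite (qbinom_out aP) mul0r big1 // => r _; rewrite !(mul0r, mulr0).
case: a => // a _ an.
have := @q_vandermonde a (n - a) n b an; rewrite subnKC // => ->.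
have -> : n%:Z - a%:Z = (n - a)%N%:Z by lia.
by rewrite mulr_sumr; apply: eq_bigr => r _; rewrite !mulrA [_ * q ^ _]mulrC.
Qed.

Lemma qbinom_convolution n m k :
  qbinom q (m + n)%N%:Z (m%:Z + k) =
  \sum_(i < m.+1) q ^ (i%:Z * (i%:Z + k)) * qbinom q m%:Z i%:Z
                  * qbinom q n%:Z (i%:Z + k).
Proof.
rewrite (@q_vandermonde m n m) // (reindex_inj rev_ord_inj) /=.
apply: eq_bigr => i _; have := ltn_ord i => im.
have -> : (m.+1 - i.+1)%N%:Z = m%:Z - i%:Z by lia.
rewrite qbinom_sym; have -> : m%:Z + k - (m%:Z - i%:Z) = i%:Z + k by ring.
by have -> : m%:Z - (m%:Z - i%:Z) = i%:Z by ring.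
Qed.

(* Linearising each product leaves a combination of the binomials
   [2k + p, k - a] whose coefficients no longer depend on [a]. *)
Lemma qbinom_linearize n (p : nat) (t a : int) : (p <= 1)%N ->
  q ^ (2 * a ^+ 2 + 2 * a * p%:Z + t * a) *
  (\sum_(i < n.+1) q ^ (i%:Z * (i%:Z + 2 * a + p%:Z + t)) * qbinom q n%:Z i%:Z
                  * qbinom q n%:Z (i%:Z + (2 * a + p%:Z))) =
  \sum_(r < n.+1) \sum_(k < n.+1)
    q ^ ((k%:Z + r%:Z) ^+ 2 + (p%:Z + t) * (k%:Z + r%:Z) + k%:Z ^+ 2 + p%:Z * k%:Z)
    * qbinom q n%:Z r%:Z * qbinom q (n%:Z - r%:Z) (2 * k%:Z + p%:Z)
    * qbinom q (2 * k%:Z + p%:Z) (k%:Z - a).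
Proof.
move=> p1; rewrite mulr_sumr.
transitivity (\sum_(i < n.+1) \sum_(r < n.+1)
  q ^ (2 * a ^+ 2 + 2 * a * p%:Z + t * a + i%:Z * (i%:Z + 2 * a + p%:Z + t) +
       (i%:Z + (2 * a + p%:Z) - r%:Z) * (i%:Z - r%:Z)) * qbinom q n%:Z r%:Z
    * qbinom q (n%:Z - r%:Z) (2 * (a + i%:Z - r%:Z) + p%:Z)
    * qbinom q (2 * (a + i%:Z - r%:Z) + p%:Z) (i%:Z - r%:Z)).
  apply: eq_bigr => i _.
  rewrite -[X in _ * X]mulrA [qbinom _ _ _ * _]mulrC qbinom_mul.
  rewrite mulrA -expfzDr // mulr_sumr.
  apply: eq_bigr => r _; rewrite !mulrA -expfzDr //.
  by have -> : i%:Z + (2 * a + p%:Z) + i%:Z - 2 * r%:Z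
            = 2 * (a + i%:Z - r%:Z) + p%:Z by ring.
rewrite exchange_big; apply: eq_bigr => r _ /=.
pose f (x : int) :=
  q ^ ((x + r%:Z) ^+ 2 + (p%:Z + t) * (x + r%:Z) + x ^+ 2 + p%:Z * x)
    * qbinom q n%:Z r%:Z * qbinom q (n%:Z - r%:Z) (2 * x + p%:Z)
    * qbinom q (2 * x + p%:Z) (x - a).
(* The substitution k = a + i - r leaves [a] only in the lower entry of the last binomial. *)
transitivity (\sum_(i < n.+1) f (a - r%:Z + i%:Z)).
  apply: eq_bigr => i _; rewrite /f.
  have -> : a + i%:Z - r%:Z = a - r%:Z + i%:Z by ring.
  have -> : a - r%:Z + i%:Z - a = i%:Z - r%:Z by ring.
  by congr (q ^ _ * _ * _ * _); ring.
have f0 x : f x != 0 -> [&& 0 <= 2 * x + p%:Z <= n%:Z - r%:Z, 0 <= x - a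
                          & x - a <= 2 * x + p%:Z].
  apply: contraR; rewrite negb_and => /orP[h|h]; rewrite /f.
    by rewrite (qbinom_out h) mulr0 mul0r.
  by rewrite (qbinom_out h) mulr0.
(* On the support, [p <= 1] turns 0 <= 2x + p into 0 <= x, and 0 <= x - a <= n - r gives the shifted
   window. *)
by rewrite -(@sum_ord_shift _ n _ f) // => x xP; apply/eqP/negPn/negP => /f0; lia.
Qed.

(** By symmetry the binomial is [2n, n + 2a], whose Vandermonde expansion is the sum linearised with
    p = t = 0. *)
Lemma qbinom_double_even n a :
  q ^ (2 * a ^+ 2) * qbinom q (2 * n)%N%:Z (n%:Z - 2 * a) =
  \sum_(r < n.+1) \sum_(k < n.+1)
    q ^ ((k%:Z + r%:Z) ^+ 2 + k%:Z ^+ 2)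
    * qbinom q n%:Z r%:Z * qbinom q (n%:Z - r%:Z) (2 * k%:Z)
    * qbinom q (2 * k%:Z) (k%:Z - a).
Proof.
have := @qbinom_linearize n 0 0 a isT; rewrite !(mulr0, mul0r, addr0).
under [in RHS]eq_bigr => r _.
  under eq_bigr => k _ do rewrite !(mulr0, mul0r, addr0).
  over.
move=> <-; congr (_ * _); rewrite -qbinom_sym.
have -> : (2 * n)%N%:Z - (n%:Z - 2 * a) = n%:Z + 2 * a by lia.
rewrite mul2n -addnn qbinom_convolution.
by apply: eq_bigr => i _; rewrite !addr0.
Qed.

Lemma qbinom_double_odd n a :
  q ^ (2 * a * (a + 1)) * qbinom q (2 * n)%N%:Z (n%:Z - 2 * a - 1) =
  \sum_(r < n.+1) \sum_(k < n.+1)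
    q ^ ((k%:Z + r%:Z) * (k%:Z + r%:Z + 1) + k%:Z * (k%:Z + 1))
    * qbinom q n%:Z r%:Z * qbinom q (n%:Z - r%:Z) (2 * k%:Z + 1)
    * qbinom q (2 * k%:Z + 1) (k%:Z - a).
Proof.
transitivity (\sum_(r < n.+1) \sum_(k < n.+1)
    q ^ ((k%:Z + r%:Z) ^+ 2 + (1%:Z + 0) * (k%:Z + r%:Z) + k%:Z ^+ 2 + 1%:Z * k%:Z)
    * qbinom q n%:Z r%:Z * qbinom q (n%:Z - r%:Z) (2 * k%:Z + 1%:Z)
    * qbinom q (2 * k%:Z + 1%:Z) (k%:Z - a)).
  rewrite -(@qbinom_linearize n 1 0 a isT); congr (q ^ _ * _); first by ring.
  rewrite -qbinom_sym.
  have -> : (2 * n)%N%:Z - (n%:Z - 2 * a - 1) = n%:Z + (2 * a + 1) by lia.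
  rewrite mul2n -addnn qbinom_convolution.
  by apply: eq_bigr => i _; congr (q ^ _ * _ * _); ring.
apply: eq_bigr => r _; apply: eq_bigr => k _.
by congr (q ^ _ * _ * _ * _); ring.
Qed.

(** Splitting 2n + 1 as (n + 1) + n yields factors [n + 1, i]. Pascal breaks them into q^i [n, i]
    and [n, i - 1], which linearise with p = 0 and p = 1 respectively; both have t = 1. *)
Lemma qbinom_double_succ n a :
  q ^ (a * (2 * a + 1)) * qbinom q (2 * n).+1%:Z (n%:Z - 2 * a) =
  \sum_(r < n.+1) \sum_(k < n.+1)
    q ^ ((k%:Z + r%:Z) * (k%:Z + r%:Z + 1) + k%:Z ^+ 2)
    * qbinom q n%:Z r%:Z * qbinom q (n%:Z - r%:Z) (2 * k%:Z)
    * qbinom q (2 * k%:Z) (k%:Z - a) +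
  \sum_(r < n.+1) \sum_(k < n.+1)
    q ^ ((k%:Z + r%:Z + 1) ^+ 2 + k%:Z * (k%:Z + 1))
    * qbinom q n%:Z r%:Z * qbinom q (n%:Z - r%:Z) (2 * k%:Z + 1)
    * qbinom q (2 * k%:Z + 1) (k%:Z - a).
Proof.
transitivity (\sum_(r < n.+1) \sum_(k < n.+1)
    q ^ ((k%:Z + r%:Z) ^+ 2 + (0%:Z + 1) * (k%:Z + r%:Z) + k%:Z ^+ 2 + 0%:Z * k%:Z)
    * qbinom q n%:Z r%:Z * qbinom q (n%:Z - r%:Z) (2 * k%:Z + 0%:Z)
    * qbinom q (2 * k%:Z + 0%:Z) (k%:Z - a) +
  q ^ 1 * (\sum_(r < n.+1) \sum_(k < n.+1)
    q ^ ((k%:Z + r%:Z) ^+ 2 + (1%:Z + 1) * (k%:Z + r%:Z) + k%:Z ^+ 2 + 1%:Z * k%:Z)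
    * qbinom q n%:Z r%:Z * qbinom q (n%:Z - r%:Z) (2 * k%:Z + 1%:Z)
    * qbinom q (2 * k%:Z + 1%:Z) (k%:Z - a))); last first.
  congr (_ + _).
    apply: eq_bigr => r _; apply: eq_bigr => k _.
    by rewrite !addr0; congr (q ^ _ * _ * _ * _); ring.
  rewrite mulr_sumr; apply: eq_bigr => r _; rewrite mulr_sumr; apply: eq_bigr => k _.
  by rewrite !mulrA -expfzDr //; congr (q ^ _ * _ * _ * _); ring.
rewrite -(@qbinom_linearize n 0 1 a isT) -(@qbinom_linearize n 1 1 a isT).
rewrite -qbinom_sym.
have -> : (2 * n).+1%:Z - (n%:Z - 2 * a) = n.+1%:Z + 2 * a by lia.
rewrite mul2n -addnn -addSn qbinom_convolution.
under eq_bigr => i _ do rewrite qbinomSl mulrDr mulrDl.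
rewrite big_split /= mulrDr addrC; congr (_ + _).
  rewrite big_ord_recr /= (@qbinom_out n%:Z n.+1%:Z); last by lia.
  rewrite !mulr0 mul0r addr0; congr (q ^ _ * _); first by ring.
  apply: eq_bigr => i _; rewrite !mulrA -expfzDr // !addr0.
  by congr (q ^ _ * _ * _); ring.
rewrite big_ord_recl /= (@qbinom_out n (0 - 1)) // mulr0 mul0r add0r.
rewrite mulrA -expfzDr // !mulr_sumr; apply: eq_bigr => i _.
rewrite /bump /= !mulrA -!expfzDr //.
have -> : (1 + i)%N%:Z - 1 = i%:Z by lia.
have -> : (1 + i)%N%:Z + 2 * a = i%:Z + (2 * a + 1) by lia.
by congr (q ^ _ * _ * _); rewrite PoszD; ring.
Qed.

End QBinomial.

(** * Nonnegative polynomials inside the field of fractions *)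

Lemma qvar_neq0 : qvar != 0.
Proof. by rewrite tofrac_eq0 polyX_eq0. Qed.

Lemma qvarX n : qvar ^+ n = tofrac 'X^n.
Proof. by rewrite -tofracXn. Qed.

Lemma qvarX_neq1 n : (0 < n)%N -> qvar ^+ n != 1.
Proof.
move=> n0; rewrite qvarX -tofrac1 tofrac_eq; apply/negP => /eqP.
by move/(congr1 (fun p : {poly int} => size p)); rewrite size_polyXn size_poly1; lia.
Qed.

Lemma coefs_ge0_0 : coefs_ge0 0.
Proof. by exists 0; rewrite ?tofrac0 // => i; rewrite coef0. Qed.

Lemma coefs_ge0D x y : coefs_ge0 x -> coefs_ge0 y -> coefs_ge0 (x + y).
Proof.
move=> [p -> p0] [r -> r0]; exists (p + r); rewrite ?tofracD // => i.
by rewrite coefD addr_ge0.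
Qed.

Lemma coefs_ge0M x y : coefs_ge0 x -> coefs_ge0 y -> coefs_ge0 (x * y).
Proof.
move=> [p -> p0] [r -> r0]; exists (p * r); rewrite ?tofracM // => i.
by rewrite coefM sumr_ge0 // => j _; rewrite mulr_ge0.
Qed.

Lemma coefs_ge0_sum (I : Type) (r : seq I) (P : pred I) f :
  (forall i, P i -> coefs_ge0 (f i)) -> coefs_ge0 (\sum_(i <- r | P i) f i).
Proof. by move=> f0; apply: big_ind => //; [exact: coefs_ge0_0|exact: coefs_ge0D]. Qed.

Lemma coefs_ge0_qvarX (z : int) : 0 <= z -> coefs_ge0 (qvar ^ z).
Proof.
case: z => // n _; exists 'X^n; first by rewrite -exprnP qvarX.
by move=> i; rewrite coefXn; case: eqP.
Qed.

Lemma coefs_ge0_1 : coefs_ge0 1.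
Proof. exact: (@coefs_ge0_qvarX 0). Qed.

Lemma coefs_ge0_qbinom (a k : int) : coefs_ge0 (qbinom qvar a k).
Proof.
case: (boolP (0 <= k <= a)) => [|/qbinom_out ->]; last exact: coefs_ge0_0.
case: a => [n|n]; last by lia.
move=> _; elim: n k => [|n IH] k.
  have [->|k0] := eqVneq k 0.
    by rewrite (qbinom0 qvarX_neq1); exact: coefs_ge0_1.
  by rewrite qbinom_out ?coefs_ge0_0 //; [exact: coefs_ge0_0 | lia].
rewrite (qbinomSl qvarX_neq1); apply: coefs_ge0D => //.
(* For k < 0 the power q^k is not a polynomial, but its binomial vanishes. *)
have [k0|k0] := leP 0 k; first by apply: coefs_ge0M => //; exact: coefs_ge0_qvarX.
by rewrite (@qbinom_out _ _ n) ?mulr0; [exact: coefs_ge0_0|lia].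
Qed.

(** Multiplying by q^c only shifts coefficients. The other factor must be known to be a polynomial,
    since q^c could also clear negative powers. *)
Lemma coefs_ge0_divX (c : int) (p : {poly int}) :
  0 <= c -> coefs_ge0 (qvar ^ c * tofrac p) -> coefs_ge0 (tofrac p).
Proof.
case: c => // c _ [r]; rewrite -exprnP qvarX -tofracM => /eqP.
rewrite tofrac_eq => /eqP <- r0; exists p => // i.
by have := r0 (i + c)%N; rewrite coefXnM; case: ltnP => [|_]; [lia|rewrite addnK].
Qed.

(** * Truncated alternating sums and their positivity *)

(** The range [-B, B] is stable under j -> -j, and one large [B] serves every level of the
    descent. *)
Definition sym_sum (V : nmodType) (B : nat) (f : int -> V) : V :=
  \sum_(i < (2 * B).+1) f (i%:Z - B%:Z).

Lemma eq_sym_sum (V : nmodType) B (f g : int -> V) :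
  (forall j, f j = g j) -> sym_sum B f = sym_sum B g.
Proof. by move=> fg; apply: eq_bigr. Qed.

Lemma sym_sumN (V : nmodType) B (f : int -> V) :
  sym_sum B (fun j => f (- j)) = sym_sum B f.
Proof.
rewrite /sym_sum [RHS](reindex_inj rev_ord_inj) /=.
apply: eq_bigr => i _; congr (f _); have := ltn_ord i; lia.
Qed.

Lemma sym_sumD (V : nmodType) B (f g : int -> V) :
  sym_sum B (fun j => f j + g j) = sym_sum B f + sym_sum B g.
Proof. exact: big_split. Qed.

Lemma sym_sumZ (V : pzRingType) B (c : V) (f : int -> V) :
  sym_sum B (fun j => c * f j) = c * sym_sum B f.
Proof. by rewrite /sym_sum mulr_sumr. Qed.

Lemma sym_sum_exchange (V : nmodType) B m n (f : 'I_m -> 'I_n -> int -> V) :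
  sym_sum B (fun j => \sum_(r < m) \sum_(k < n) f r k j) =
  \sum_(r < m) \sum_(k < n) sym_sum B (f r k).
Proof.
rewrite /sym_sum exchange_big; apply: eq_bigr => r _.
by rewrite exchange_big.
Qed.

Lemma signz_opp (V : unitRingType) (j : int) : (-1 : V) ^ (- j) = (-1) ^ j.
Proof. by rewrite -exprz_inv invrN1. Qed.

(* For [e = 0] this is Bressoud's polynomial [G(N, n - N, 1, 1, v)], and for
   [e = 1] it is [G(N, n - N, 0, 2, v)], truncated to [-B <= j <= B]. *)
Definition alt_sum (v B : nat) (e : int) (n : nat) (N : int) :=
  sym_sum B (fun j : int => (-1) ^ j * qvar ^ (v%:Z * j * (j - e))
                            * qbinom qvar n%:Z (N - v%:Z * j)).

Lemma alt_sum_sym v B n N : alt_sum v B 0 n (n%:Z - N) = alt_sum v B 0 n N.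
Proof.
rewrite /alt_sum -sym_sumN; apply: eq_sym_sum => j; rewrite signz_opp.
rewrite -[in RHS]qbinom_sym; congr (_ * qvar ^ _ * qbinom _ _ _); ring.
Qed.

(** The Pascal factor q^(N - v j) turns v j^2 into v j (j - 1), up to q^N. The other Pascal rule
    reverses this in [alt_sum1S]. *)
Lemma alt_sum0S v B n N :
  alt_sum v B 0 n.+1 N = alt_sum v B 0 n (N - 1) + qvar ^ N * alt_sum v B 1 n N.
Proof.
rewrite /alt_sum -sym_sumZ -sym_sumD; apply: eq_sym_sum => j.
rewrite (qbinomSl qvarX_neq1) mulrDr; congr (_ * qbinom _ _ _ + _); first by ring.
rewrite !mulrA; congr (_ * _); rewrite ![_ * (-1) ^ j]mulrC -!mulrA.
by rewrite -!(expfzDr _ _ qvar_neq0); congr (_ * _ ^ _); ring.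
Qed.

Lemma alt_sum1S v B n N :
  alt_sum v B 1 n.+1 N =
  alt_sum v B 1 n N + qvar ^ (n.+1%:Z - N) * alt_sum v B 0 n (N - 1).
Proof.
rewrite /alt_sum -sym_sumZ -sym_sumD; apply: eq_sym_sum => j.
rewrite (qbinomSr qvarX_neq1) mulrDr; congr (_ + _).
have -> : N - v%:Z * j - 1 = N - 1 - v%:Z * j by ring.
rewrite !mulrA; congr (_ * _); rewrite ![_ * (-1) ^ j]mulrC -!mulrA.
by rewrite -!(expfzDr _ _ qvar_neq0); congr (_ * _ ^ _); ring.
Qed.

(** The term j = 0 vanishes since [N] is out of range. Any other shift v j has size at least v, so
    it moves further out or, as |2N - n| <= v, jumps over all of [0, n]. *)
Lemma alt_sum_out v B e n N :
  - v%:Z <= 2 * N - n%:Z <= v%:Z -> ~~ (0 <= N <= n%:Z) -> alt_sum v B e n N = 0.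
Proof.
move=> /andP[d1 d2] NP; rewrite /alt_sum /sym_sum big1 // => i _.
move: (i%:Z - B%:Z) => j; rewrite qbinom_out ?mulr0 //.
have [->|j0] := eqVneq j 0; first by rewrite mulr0 subr0.
have : v%:Z * j <= - v%:Z \/ v%:Z <= v%:Z * j by nia.
by lia.
Qed.

(* The reflection [j -> 1 - j] exchanges equal terms of opposite signs. *)
Lemma alt_sum1_eq0 v B n N :
  (n < B)%N -> (0 < v)%N -> 2 * N - n%:Z = v%:Z -> alt_sum v B 1 n N = 0.
Proof.
move=> nB v0 NE; rewrite /alt_sum.
set f := fun j : int => _.
have fN j : f (1 - j) = - f j.
  rewrite /f -qbinom_sym expfzDr ?oppr_eq0 ?oner_eq0 // signz_opp.
  rewrite expr1z -!mulrA mulN1r; congr (- (_ * (qvar ^ _ * qbinom _ _ _))); first by ring.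
  by lia.
(* The reflection preserves only [1 - B, B]; the unpaired term j = -B lies outside the support. *)
have fB : f (- B%:Z) = 0 by rewrite /f qbinom_out ?mulr0 //; nia.
have S2 : sym_sum B f = - sym_sum B f.
  rewrite /sym_sum big_ord_recl /= sub0r fB add0r.
  rewrite [LHS](reindex_inj rev_ord_inj) /= -sumrN; apply: eq_bigr => i _.
  rewrite -fN; congr f; have := ltn_ord i; rewrite /bump /=; lia.
have : (2 : {fraction {poly int}}) * sym_sum B f = 0.
  by rewrite mulr_natl mulr2n {1}S2 addNr.
move/eqP; rewrite mulf_eq0 => /orP[|/eqP //].
rewrite -(rmorph_nat (@tofrac {poly int})) tofrac_eq0 -polyC_natr polyC_eq0.
by [].
Qed.

(** Simultaneous induction on [n]: a Pascal step changes d = 2N - n by one, and the two windows for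
    d are chosen so that the recurrences fail only at d = 1 - v for e = 0 and at d = v for e = 1. *)
Lemma alt_sum_ge0 v B n N : (2 <= v)%N -> (n < B)%N ->
  (1 - v%:Z <= 2 * N - n%:Z <= v%:Z - 1 -> coefs_ge0 (alt_sum v B 0 n N)) /\
  (2 - v%:Z <= 2 * N - n%:Z <= v%:Z -> coefs_ge0 (alt_sum v B 1 n N)).
Proof.
move=> v2; elim: n N => [|n IH] N nB.
  have base e : - v%:Z <= 2 * N - 0%:Z <= v%:Z -> coefs_ge0 (alt_sum v B e 0 N).
    have [->|N0] := eqVneq N 0; last first.
      by move=> d; rewrite alt_sum_out; [exact: coefs_ge0_0 | | lia].
    move=> _; apply: coefs_ge0_sum => i _.
    have [->|j0] := eqVneq (i%:Z - B%:Z) 0.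
      by rewrite !mulr0 mul0r !expr0z !mul1r; exact: coefs_ge0_qbinom.
    by rewrite qbinom_out ?mulr0; [exact: coefs_ge0_0 | nia].
  by split => d; apply: base; lia.
have {}IH M := IH M (ltnW nB).
have H0 M : 2 - v%:Z <= 2 * M - n.+1%:Z <= v%:Z - 1 -> coefs_ge0 (alt_sum v B 0 n.+1 M).
  (* The recurrence needs M >= 0 for q^M to be a polynomial; out of range the sum is zero. *)
  move=> d; case: (boolP (0 <= M <= n.+1%:Z)) => [/andP[M0 _]|MP]; last first.
    by rewrite alt_sum_out //; [exact: coefs_ge0_0 | lia].
  rewrite alt_sum0S; apply: coefs_ge0D; first by apply: (IH _).1; lia.
  by apply: coefs_ge0M; [exact: coefs_ge0_qvarX | apply: (IH _).2; lia].
split=> d.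
  (* Symmetry moves the end 1 - v to v - 1, which [H0] covers because v >= 2. *)
  have [d'|d'] := eqVneq (2 * N - n.+1%:Z) (1 - v%:Z); last by apply: H0; lia.
  by rewrite -alt_sum_sym; apply: H0; lia.
have [d'|d'] := eqVneq (2 * N - n.+1%:Z) v%:Z.
  by rewrite alt_sum1_eq0 //; [exact: coefs_ge0_0 | lia].
case: (boolP (0 <= N <= n.+1%:Z)) => [/andP[_ Nn]|NP]; last first.
  by rewrite alt_sum_out //; [exact: coefs_ge0_0 | lia].
rewrite alt_sum1S; apply: coefs_ge0D; first by apply: (IH _).2; lia.
by apply: coefs_ge0M; [apply: coefs_ge0_qvarX; lia | apply: (IH _).1; lia].
Qed.

(** * The descent through the levels *)

(** The coefficients [c r k] do not depend on [j], so they come out of the sum over [j]. Each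
    descent step has this shape. *)
Lemma sym_sum_transform_ge0 B m n (c : 'I_m -> 'I_n -> {fraction {poly int}})
    (g : int -> {fraction {poly int}}) (h : 'I_n -> int -> {fraction {poly int}}) :
  (forall r k, coefs_ge0 (c r k)) ->
  (forall k, coefs_ge0 (sym_sum B (fun j => g j * h k j))) ->
  coefs_ge0 (sym_sum B (fun j => g j * \sum_(r < m) \sum_(k < n) c r k * h k j)).
Proof.
move=> c0 gh0.
rewrite (_ : sym_sum _ _ = \sum_(r < m) \sum_(k < n)
                             c r k * sym_sum B (fun j => g j * h k j)).
  by apply: coefs_ge0_sum => r _; apply: coefs_ge0_sum => k _; exact: coefs_ge0M.
under [RHS]eq_bigr => r _ do under eq_bigr => k _ do rewrite -sym_sumZ.
rewrite -sym_sum_exchange; apply: eq_sym_sum => j; rewrite mulr_sumr.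
apply: eq_bigr => r _; rewrite mulr_sumr; apply: eq_bigr => k _.
by rewrite mulrCA.
Qed.

(** [qbinom_double_succ] at a = v j uses up v j (2 v j + 1) of the exponent and leaves v j^2. The
    resulting alternating sums have 2N - n equal to 0 or -1, within the positivity window as v >=
    2. *)
Lemma odd_sum_ge0 v B l : (2 <= v)%N -> ((2 * l).+1 < B)%N ->
  coefs_ge0 (sym_sum B (fun j : int =>
    (-1) ^ j * qvar ^ (v%:Z * j * ((2 * v%:Z + 1) * j + 1))
    * qbinom qvar (2 * l).+1%:Z (l%:Z - 2 * (v%:Z * j)))).
Proof.
move=> v2 lB.
pose g (j : int) : {fraction {poly int}} := (-1) ^ j * qvar ^ (v%:Z * j * (j - 0)).
rewrite (_ : sym_sum _ _ = sym_sum B (fun j => g j *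
   (qvar ^ (v%:Z * j * (2 * (v%:Z * j) + 1))
    * qbinom qvar (2 * l).+1%:Z (l%:Z - 2 * (v%:Z * j))))); last first.
  apply: eq_sym_sum => j; rewrite /g -!mulrA; congr (_ * _); rewrite !mulrA.
  by rewrite -(expfzDr _ _ qvar_neq0); congr (_ ^ _ * _); ring.
under eq_sym_sum => j do
  rewrite (qbinom_double_succ qvarX_neq1 qvar_neq0) mulrDr.
rewrite sym_sumD; apply: coefs_ge0D; apply: sym_sum_transform_ge0.
- move=> r k; do 2?[apply: coefs_ge0M]; try exact: coefs_ge0_qbinom.
  by apply: coefs_ge0_qvarX; nia.
- move=> k; have kl := ltn_ord k; have kB : (2 * k < B)%N by lia.
  have -> : 2 * k%:Z = (2 * k)%N%:Z by lia.
  by apply: (alt_sum_ge0 k%:Z v2 kB).1; lia.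
- move=> r k; do 2?[apply: coefs_ge0M]; try exact: coefs_ge0_qbinom.
  by apply: coefs_ge0_qvarX; nia.
- move=> k; have kl := ltn_ord k; have kB : ((2 * k).+1 < B)%N by lia.
  have -> : 2 * k%:Z + 1 = (2 * k).+1%:Z by lia.
  by apply: (alt_sum_ge0 k%:Z v2 kB).1; lia.
Qed.

(** For h = 2^(n-2) and 3m + 1 = 4^n this is the polynomial of the theorem, with K = 4 h v and
    integer exponents, truncated to -B <= j <= B. *)
Definition tower_sum (v m h B L : nat) :=
  sym_sum B (fun j : int =>
    (-1) ^ j * qvar ^ (v%:Z * j * ((2 * v%:Z * m%:Z + 1) * j + m%:Z))
    * qbinom qvar (2 * L)%N%:Z (L%:Z - h%:Z * (1 + 4 * v%:Z * j))).

(** Level 2, where m = (4^2 - 1)/3 = 5 and h = 1: [qbinom_double_odd] at a = 2 v j reduces to the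
    sums of [odd_sum_ge0]. *)
Lemma tower_sum_base v B L : (2 <= v)%N -> ((2 * L).+1 < B)%N ->
  coefs_ge0 (tower_sum v 5 1 B L).
Proof.
move=> v2 LB.
pose g (j : int) : {fraction {poly int}} :=
  (-1) ^ j * qvar ^ (v%:Z * j * ((2 * v%:Z + 1) * j + 1)).
rewrite /tower_sum (@eq_sym_sum _ B _ (fun j => g j *
   (qvar ^ (2 * (2 * (v%:Z * j)) * (2 * (v%:Z * j) + 1))
    * qbinom qvar (2 * L)%N%:Z (L%:Z - 2 * (2 * (v%:Z * j)) - 1)))); last first.
  move=> j; rewrite /g -!mulrA; congr (_ * _); rewrite [RHS]mulrA.
  rewrite -(expfzDr _ _ qvar_neq0); congr (_ ^ _ * qbinom _ _ _); ring.
under eq_sym_sum => j do rewrite (qbinom_double_odd qvarX_neq1 qvar_neq0).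
apply: sym_sum_transform_ge0.
  move=> r k; do 2?[apply: coefs_ge0M]; try exact: coefs_ge0_qbinom.
  by apply: coefs_ge0_qvarX; nia.
move=> k; have kl := ltn_ord k.
have -> : 2 * k%:Z + 1 = (2 * k).+1%:Z by lia.
by apply: odd_sum_ge0; lia.
Qed.

(** For a = h (1 + 4 v j), 2 a^2 = 2 h^2 + 16 h^2 v j (2 v j + 1). As 16 h^2 = 3m + 1, the second
    part turns [m] into 4m + 1, while the constant 2 h^2 is added to [c]. *)
Lemma tower_sum_step v m h B L (c : int) : (3 * m + 1 = 16 * h ^ 2)%N ->
  (forall k, (k <= L)%N -> coefs_ge0 (qvar ^ c * tower_sum v m h B k)) ->
  coefs_ge0 (qvar ^ (c + 2 * h%:Z ^+ 2) * tower_sum v (4 * m + 1) (2 * h) B L).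
Proof.
move=> mh IH; have {mh}mh : 3 * m%:Z + 1 = 16 * h%:Z ^+ 2 by lia.
pose a (j : int) := h%:Z * (1 + 4 * v%:Z * j).
pose g (j : int) : {fraction {poly int}} :=
  qvar ^ c * ((-1) ^ j * qvar ^ (v%:Z * j * ((2 * v%:Z * m%:Z + 1) * j + m%:Z))).
rewrite /tower_sum -sym_sumZ (@eq_sym_sum _ B _ (fun j => g j *
   (qvar ^ (2 * a j ^+ 2) * qbinom qvar (2 * L)%N%:Z (L%:Z - 2 * a j)))); last first.
  move=> j; rewrite /g [qvar ^ c * _]mulrCA -!mulrA [LHS]mulrCA; congr (_ * _).
  rewrite !mulrA -!(expfzDr _ _ qvar_neq0); congr (_ ^ _ * qbinom _ _ _).
  have -> : (4 * m + 1)%N%:Z = 4 * m%:Z + 1 by lia.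
  transitivity (c + 2 * h%:Z ^+ 2 + v%:Z * j * ((2 * v%:Z * m%:Z + 1) * j + m%:Z)
                + (3 * m%:Z + 1) * (v%:Z * j * (2 * v%:Z * j + 1))); first by ring.
  by rewrite mh; ring.
under eq_sym_sum => j do rewrite (qbinom_double_even qvarX_neq1 qvar_neq0).
apply: sym_sum_transform_ge0.
  move=> r k; do 2?[apply: coefs_ge0M]; try exact: coefs_ge0_qbinom.
  by apply: coefs_ge0_qvarX; nia.
move=> k; have kl := ltn_ord k.
move: (IH k kl); rewrite /tower_sum -sym_sumZ; congr coefs_ge0.
by apply: eq_sym_sum => j; rewrite /g !mulrA PoszM.
Qed.

(** Allows the power of q gathered in the descent to be cancelled. *)
Lemma tower_sum_poly v m h B L : (0 < v)%N ->
  exists p : {poly int}, tower_sum v m h B L = tofrac p.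
Proof.
move=> v0; rewrite /tower_sum /sym_sum.
apply: (big_ind (fun x => exists p : {poly int}, x = tofrac p)).
- by exists 0; rewrite tofrac0.
- by move=> _ _ [p ->] [r ->]; exists (p + r); rewrite tofracD.
move=> i _; move: (i%:Z - B%:Z) => j.
have [x ->] : exists p : {poly int}, (-1) ^ j = tofrac p.
  case: j => n; first by exists ((-1) ^+ n); rewrite tofracXn tofracN tofrac1.
  by exists ((-1) ^+ n.+1); rewrite NegzE signz_opp tofracXn tofracN tofrac1.
have [y -> _] : coefs_ge0 (qvar ^ (v%:Z * j * ((2 * v%:Z * m%:Z + 1) * j + m%:Z))).
  apply: coefs_ge0_qvarX; rewrite -mulrA; apply: mulr_ge0 => //.
  (* For j <= -1 the second factor is negative as well, because 2 v m >= m. *)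
  have [j0|j0] := leP 0 j; first by nia.
  have vm : 2 * m%:Z <= 2 * v%:Z * m%:Z by nia.
  have : (2 * v%:Z * m%:Z + 1) * j <= - (2 * v%:Z * m%:Z + 1) by nia.
  nia.
have [z -> _] := coefs_ge0_qbinom (2 * L)%N%:Z (L%:Z - h%:Z * (1 + 4 * v%:Z * j)).
by exists (x * y * z); rewrite !tofracM.
Qed.

Lemma tower_sum_ge0 v s m B L : (2 <= v)%N -> (3 * m + 1 = 4 ^ s.+2)%N ->
  ((2 * L).+1 < B)%N -> coefs_ge0 (tower_sum v m (2 ^ s) B L).
Proof.
move=> v2 mE LB.
(* The induction on [s] only reaches the sum times q^c, with [c] common to all k <= L. *)
suff [c c0 H] : exists2 c : int, 0 <= c &
    forall k, (k <= L)%N -> coefs_ge0 (qvar ^ c * tower_sum v m (2 ^ s) B k).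
  have [p pE] := @tower_sum_poly v m (2 ^ s) B L (ltnW v2).
  by have := H L (leqnn L); rewrite pE; exact: coefs_ge0_divX.
elim: s m mE => [|s IH] m mE.
  exists 0 => // k kL; rewrite expr0z mul1r.
  have -> : m = 5%N by move: mE; rewrite (_ : 4 ^ 2 = 16)%N //; lia.
  by apply: tower_sum_base => //; lia.
have [m' m'E] : exists m', (3 * m' + 1 = 4 ^ s.+2)%N.
  have : (0 < 4 ^ s.+2)%N by rewrite expn_gt0.
  by move: mE; rewrite expnS; exists ((m - 1) %/ 4)%N; lia.
have [c c0 H] := IH m' m'E; exists (c + 2 * (2 ^ s)%N%:Z ^+ 2).
  by rewrite addr_ge0 // mulr_ge0 // exprn_ge0.
move=> k kL; have -> : m = (4 * m' + 1)%N by move: mE; rewrite expnS; lia.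
rewrite expnS; apply: tower_sum_step.
  by rewrite m'E -(expnM 2 s) [(s * 2)%N]mulnC expnM !expnS mulnA.
by move=> k' k'k; apply: H; exact: leq_trans kL.
Qed.

(** * Matching G with the level-n tower sum *)

Theorem theorem5p5 (R : realType) (v n : nat) (hv : (2 <= v)%N) (hn : (2 <= n)%N)
    (L : nat) :
  coefs_ge0
    (G (L%:Z - (2 ^ (n - 2))%N%:Z) (L%:Z + (2 ^ (n - 2))%N%:Z)
       (2 * v%:R * ((2 ^+ n - 2 ^- n) / 3) + (2 ^+ n + 2 ^ (1 - n%:Z)) / 3 : R)
       (2 * v%:R * ((2 ^+ n - 2 ^- n) / 3) + (2 ^ (2 - n%:Z) - 2 ^+ n) / 3 : R)
       (2 ^ n * v)%N qvar).
Proof.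
have [m mE] : exists m : nat, (3 * m + 1 = 4 ^ n)%N.
  have : (4 ^ n %% 3 = 1)%N by rewrite -modnXm exp1n.
  by exists (4 ^ n %/ 3)%N; lia.
have mR : (m%:R : R) = (2 ^+ n * 2 ^+ n - 1) / 3.
  by rewrite -exprMn -natrM -natrX -mE natrD natrM; field.
have two0 : (2 : R) != 0 by rewrite pnatr_eq0.
have pow0 : (2 : R) ^+ n != 0 by rewrite expf_neq0.
set h := (2 ^ (n - 2))%N.
have hE : (2 ^ n = 4 * h)%N by rewrite -{1}(subnK hn) expnD mulnC.
have h0 : (0 < h)%N by rewrite expn_gt0.
(* Exceeds 2L + 1, as the descent requires, and L + h, which bounds |K j| on the support. *)
pose B := (2 * L + h + 2)%N.
have : coefs_ge0 (tower_sum v m h B L).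
  by apply: tower_sum_ge0; rewrite ?mE //; [congr (_ ^ _)%N; lia | rewrite /B; lia].
congr coefs_ge0; rewrite /G (@fsbig_int_interval _ (- B%:Z) (2 * B).+1); last first.
  move=> j jP; rewrite qbinom_out ?mulr0 //.
  have : B%:Z < j \/ j < - B%:Z by lia.
  have : 1 <= (2 ^ n * v)%N%:Z by rewrite hE; nia.
  by rewrite /B; nia.
rewrite /tower_sum /sym_sum; apply: eq_bigr => i _; rewrite [- _ + _]addrC.
move: (i%:Z - B%:Z) => j.
(* Since m = (4^n - 1)/3, the real exponent is this integer and the floor disappears. *)
rewrite (_ : Gexponent _ _ _ _ =
  (v%:Z * j * ((2 * v%:Z * m%:Z + 1) * j + m%:Z))%:~R); last first.
  rewrite /Gexponent !expfzDr // -!exprnN natrM natrX.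
  by rewrite !(rmorphM, rmorphD) /= -!pmulrn mR; field.
rewrite intrKfloor; congr (_ * _ * qbinom _ _ _); first by lia.
by rewrite hE !PoszM; ring.
Qed.
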